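(* For each positive integer $n$, let $f(n)$ denote the minimum number of cops needed to win Covering (against a robber of speed $2$) on the grid $[n]^2$. Then $f(n)=\Omega(n^{1.357})$; that is, there exist a constant $c>0$ and an integer $n_0$ such that $f(n)\ge c\,n^{1.357}$ for all $n\ge n_0$.
   Context: The grid $[n]^2$ is the graph with vertex set $\{1,\dots,n\}^2$ in which two distinct vertices are adjacent if and only if each coordinate differs by at most $1$ (so graph distance is the $l_\infty$ distance). The game of Covering on a graph $G$ is a perfect information game played by a team of cops and one robber, each occupying vertices of $G$ (several cops may occupy the same vertex). The cops choose the starting configuration, meaning the initial vertices of all the cops and of the robber. The two sides then take turns alternately forever, the cops going first. On the cops' turn, each cop moves to an adjacent vertex or stays put. On the robber's turn, he moves to any vertex at graph distance at most $2$ from his current vertex (possibly staying put). The cops win if after every one of their turns at least one cop occupies the same vertex as the robber. A number $m$ of cops ''can win'' if $m$ cops have a strategy guaranteeing this against every play of the robber; the number of cops needed to win Covering on $G$ is the minimum such $m$. *)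

(* Defs.v *)
From HB Require Import structures.
From mathcomp Require Import all_boot all_order all_algebra.
From mathcomp Require Import boolp classical_sets reals exp.

Set Implicit Arguments.
Unset Strict Implicit.
Unset Printing Implicit Defensive.

Local Open Scope nat_scope.

(* A graph is a finite type of vertices together with an adjacency relation.  *)

(* The graph distance from x to y is at most k. *)
Definition dist_le (V : finType) (adj : rel V) (k : nat) (x y : V) : Prop :=
  exists p : seq V, [/\ path adj x p, last x p = y & size p <= k].

Definition cop_conf (V : finType) (m : nat) : finType := {ffun 'I_m -> V}.

(* The positions at times 0, ..., t, where time 0 is the start and time s.+1  *)
(* is the end of the s-th round (a cop turn followed by a robber turn).       *)
Definition history (V : finType) (m : nat)
    (C : nat -> cop_conf V m) (r : nat -> V) (t : nat) : seq (cop_conf V m * V) :=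
  [seq (C s, r s) | s <- iota 0 t.+1].

(* In round t the cops move from C t to C t.+1, at which moment the robber is *)
(* still at r t and must be covered; he then moves from r t to r t.+1.        *)
Definition cops_can_win (V : finType) (adj : rel V) (speed m : nat) : Prop :=
  exists (c0 : cop_conf V m) (r0 : V)
         (strategy : seq (cop_conf V m * V) -> cop_conf V m),
  forall (C : nat -> cop_conf V m) (r : nat -> V),
    C 0 = c0 -> r 0 = r0 ->
    (forall t, C t.+1 = strategy (history C r t)) ->
    (forall t, dist_le adj speed (r t) (r t.+1)) ->
  forall t, (forall i, C t.+1 i = C t i \/ adj (C t i) (C t.+1 i)) /\
            (exists i, C t.+1 i = r t).

Definition is_covering_number (V : finType) (adj : rel V) (speed k : nat) : Prop :=
  cops_can_win adj speed k /\
  forall m, cops_can_win adj speed m -> k <= m.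

(* The value 0 is only taken when V is empty, see covering_numberP. *)
Definition covering_number (V : finType) (adj : rel V) (speed : nat) : nat :=
  xget 0 [set k | is_covering_number adj speed k]%classic.

Lemma cops_can_win_card (V : finType) (adj : rel V) (speed : nat) (v : V) :
  cops_can_win adj speed #|V|.
Proof.
pose c : cop_conf V #|V| := [ffun i => enum_val i].
exists c, v, (fun=> c) => C r C0 _ CS _ t.
have Cc s : C s = c by case: s.
split=> [i|]; first by left; rewrite !Cc.
by exists (enum_rank (r t)); rewrite Cc ffunE enum_rankK.
Qed.

Lemma covering_numberP (V : finType) (adj : rel V) (speed : nat) (v : V) :
  is_covering_number adj speed (covering_number adj speed).
Proof.
have ex : exists m, `[< cops_can_win adj speed m >].
  by exists #|V|; apply/asboolP/cops_can_win_card.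
apply: (xgetPex 0); exists (ex_minn ex); rewrite /=.
case: ex_minnP => k /asboolP kwin kmin; split=> // m mwin.
exact/kmin/asboolP.
Qed.

(* Coordinates range over 0, ..., n - 1 instead of 1, ..., n. *)
Definition grid_adj (n : nat) : rel ('I_n * 'I_n) :=
  fun u v => [&& u != v, `|u.1 - v.1| <= 1 & `|u.2 - v.2| <= 1].

Definition grid_covering_number (n : nat) : nat :=
  covering_number (@grid_adj n) 2.

(* Main.v *)
From Stdlib Require Import NArith.
Require Import Defs.
From mathcomp Require Import all_boot all_order all_algebra zify lra.
From mathcomp Require Import boolp reals exp.

(** The robber threatens many places at once. Fix a tree of routes in the grid,
all starting from one vertex, that he walks at full speed. A cop who covers the
end of a route in one play and the end of another route in another play stands
at the same vertex in both plays when the routes part, so the two ends are at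
most as far apart as the number of moves between them along the tree. If on the
contrary any two ends are further apart than that, every route needs a cop of
its own ([separated_walks_le]). It remains to put a large tree of this kind
into the grid, that is, a tree in which the distance along the branches is less
than twice the grid distance, one move of the robber being a step of length 2.

After a rotation by an eighth of a turn the grid distance is the l1 distance of
the plane, and trees with horizontal and vertical branches become suitable. The
tree used here is a self-similar comb ([cell]): a stem that carries on both
sides rotated copies of smaller combs. All sizes are powers of 2. The copies of
height [h] stand at the odd multiples of [h], as far as [3 x + h] does not
exceed the height of the whole comb, where [x] is the position on the stem. Two
linear inequalities on the length and the end of a route ([in_cell]) are
inherited by the larger comb ([in_cell_tooth]), and they imply that copies are
separated whenever they are on opposite sides of the stem or their feet are at
least the smaller of their heights apart ([separated_tooth_opposite],
[separated_tooth_far]).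

The number of copies of each height is a Jacobsthal number, and for the numbers
[N k] of routes of the combs this gives [N (k + 2) = N (k + 1) + 4 N k] for [k
> 0] ([size_cell_rec]). Hence [N k] grows like [((1 + sqrt 17) / 2) ^ k],
whereas the side of the grid that contains the comb doubles with [k]. The
exponent is therefore the binary logarithm of [(1 + sqrt 17) / 2], which
exceeds 1.357 by less than 0.00002. *)

Set Implicit Arguments.
Unset Strict Implicit.
Unset Printing Implicit Defensive.

Import Order.TTheory GRing.Theory Num.Theory.
Local Open Scope nat_scope.

(** * Cop and robber trajectories *)

Lemma dist_le_refl (V : finType) (adj : rel V) x : dist_le adj 0 x x.
Proof. by exists [::]. Qed.

Lemma dist_leW (V : finType) (adj : rel V) j k x y :
  j <= k -> dist_le adj j x y -> dist_le adj k x y.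
Proof. by move=> jk [p [pp lp sp]]; exists p; split=> //; apply: leq_trans jk. Qed.

Lemma dist_le_trans (V : finType) (adj : rel V) j k y x z :
  dist_le adj j x y -> dist_le adj k y z -> dist_le adj (j + k) x z.
Proof.
move=> [p [pp lp sp]] [q [pq lq sq]]; exists (p ++ q).
by rewrite cat_path last_cat lp pp pq size_cat leq_add.
Qed.

Lemma dist_le_sym (V : finType) (adj : rel V) k x y :
  symmetric adj -> dist_le adj k x y -> dist_le adj k y x.
Proof.
move=> adj_sym [p [pp lp sp]]; exists (rev (belast x p)); split.
- by rewrite -lp (rev_path adj) (eq_path (e' := adj)).
- by case: p {pp sp} lp => //= a p _; rewrite rev_cons last_rcons.
- by rewrite size_rev size_belast.
Qed.

Lemma cop_dist_le (V : finType) (adj : rel V) m (C : nat -> cop_conf V m) i s t :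
    (forall t, C t.+1 i = C t i \/ adj (C t i) (C t.+1 i)) ->
  dist_le adj t (C s i) (C (s + t) i).
Proof.
move=> mv; elim: t => [|t IH]; first by rewrite addn0; apply: dist_le_refl.
rewrite addnS -addn1; apply: dist_le_trans IH _.
case: (mv (s + t)) => [->|a]; first exact: dist_leW (dist_le_refl _ _).
by exists [:: C (s + t).+1 i]; rewrite /= a.
Qed.

Fixpoint response_history (V : finType) (m : nat) (c0 : cop_conf V m)
    (strategy : seq (cop_conf V m * V) -> cop_conf V m) (r : nat -> V) t :
    seq (cop_conf V m * V) :=
  if t is t'.+1 then
    let h := response_history c0 strategy r t' in rcons h (strategy h, r t)
  else [:: (c0, r 0)].

(** The cops' moves when they follow their strategy against a robber whose
whole trajectory is fixed in advance. *)
Definition response (V : finType) (m : nat) (c0 : cop_conf V m)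
    (strategy : seq (cop_conf V m * V) -> cop_conf V m) (r : nat -> V) t :
    cop_conf V m :=
  if t is t'.+1 then strategy (response_history c0 strategy r t') else c0.

Lemma response_historyE (V : finType) (m : nat) (c0 : cop_conf V m)
    (strategy : seq (cop_conf V m * V) -> cop_conf V m) (r : nat -> V) t :
  response_history c0 strategy r t = history (response c0 strategy r) r t.
Proof.
elim: t => [//|t IH]; rewrite /history -(addn1 t.+1) (iotaD 0 t.+1 1) map_cat.
by rewrite cats1 add0n [LHS]/= {1}IH.
Qed.

(** The robber may therefore choose his route as late as he likes: two routes
are answered in the same way until they part. *)
Lemma response_history_local (V : finType) (m : nat) (c0 : cop_conf V m)
    (strategy : seq (cop_conf V m * V) -> cop_conf V m) (r r' : nat -> V) t :
    (forall s, s <= t -> r s = r' s) ->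
  response_history c0 strategy r t = response_history c0 strategy r' t.
Proof.
elim: t => [|t IH] e /=; first by rewrite e.
by rewrite IH ?e // => s st; apply: e; apply: leqW.
Qed.

(** The strategy answers infinite plays, so the robber stays for ever at the
last vertex of his walk. *)
Definition trajectory (V : Type) (x : V) (w : seq V) (t : nat) : V :=
  nth (last x w) (x :: w) t.

Lemma trajectory_last (V : Type) (x : V) w : trajectory x w (size w) = last x w.
Proof. by rewrite /trajectory [RHS](last_nth (last x w)). Qed.

Lemma trajectory_cat (V : Type) (x : V) u p t :
  t <= size u -> trajectory x (u ++ p) t = trajectory x u t.
Proof.
move=> tu; rewrite /trajectory -cat_cons nth_cat ltnS tu.
by apply: set_nth_default; rewrite ltnS.
Qed.

Lemma trajectory_step (V : finType) (adj : rel V) speed x w t :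
    path (fun u v => `[< dist_le adj speed u v >]) x w ->
  dist_le adj speed (trajectory x w t) (trajectory x w t.+1).
Proof.
move=> /(pathP (last x w)) pw; case: (ltnP t (size w)) => [tw|wt].
  exact/asboolP/pw.
rewrite /trajectory [nth _ _ t.+1]nth_default //.
have [->|tw] := eqVneq t (size w).
  by rewrite -(last_nth (last x w) x w); apply: dist_leW (dist_le_refl _ _).
by rewrite nth_default; [apply: dist_leW (dist_le_refl _ _)|rewrite /=; lia].
Qed.

(** Let each walk choose a cop that covers its end. If one cop were chosen by
two walks [u ++ p] and [u ++ q], then, since the cops cannot tell these walks
apart before the end of [u], this cop would be at the same vertex at that
moment in both plays, and from there within [size p] of one end and within
[size q] of the other. When the ends are further apart than [size p + size q],
the choice is injective. *)
Lemma separated_walks_le (V : finType) (adj : rel V) (speed m : nat)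
    (I : finType) (o : V) (walk : I -> seq V) :
    symmetric adj -> 0 < speed -> (forall x, connect adj x o) ->
    (forall i, path (fun u v => `[< dist_le adj speed u v >]) o (walk i)) ->
    (forall i j, i != j -> exists u p q,
       [/\ walk i = u ++ p, walk j = u ++ q
         & ~ dist_le adj (size p + size q) (last o (walk i)) (last o (walk j))]) ->
  cops_can_win adj speed m -> #|I| <= m.
Proof.
move=> adj_sym sp_gt0 conn walkP sep [c0 [r0 [strategy win]]].
have [p0 pp0 lp0] := connectP (conn r0).
(* The cops choose where the robber starts, so he goes to [o] first. *)
pose W i := p0 ++ walk i.
pose C i := response c0 strategy (trajectory r0 (W i)).
have WP i : path (fun u v => `[< dist_le adj speed u v >]) r0 (W i).
  rewrite cat_path -lp0 walkP andbT; apply: sub_path pp0 => u v uv.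
  by apply/asboolP; exists [:: v]; rewrite /= uv.
have CP i t : (forall c, C i t.+1 c = C i t c \/ adj (C i t c) (C i t.+1 c)) /\
              (exists c, C i t.+1 c = trajectory r0 (W i) t).
  apply: win => // s; first by rewrite -response_historyE.
  exact: trajectory_step (WP i).
have /choice [phi phiP] : forall i, exists c,
    C i (size (W i)).+1 c = last o (walk i).
  move=> i; have [_ [c ec]] := CP i (size (W i)).
  by exists c; rewrite ec trajectory_last last_cat -lp0.
suff phi_inj : injective phi.
  by have := leq_card phi phi_inj; rewrite card_ord.
move=> i j eij; apply/eqP; apply: contraT => /sep [u [p [q [wi wj []]]]].
have ui : W i = (p0 ++ u) ++ p by rewrite /W wi catA.
have uj : W j = (p0 ++ u) ++ q by rewrite /W wj catA.
pose s := size (p0 ++ u).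
have eC : C i s.+1 = C j s.+1.
  rewrite /C /=; congr strategy; apply: response_history_local => t ts.
  by rewrite ui uj (trajectory_cat _ p ts) (trajectory_cat _ q ts).
have di : dist_le adj (size p) (C i s.+1 (phi i)) (last o (walk i)).
  rewrite -phiP ui size_cat -addSn.
  by apply: cop_dist_le => t; have [] := CP i t.
have dj : dist_le adj (size q) (C i s.+1 (phi i)) (last o (walk j)).
  rewrite eC eij -phiP uj size_cat -addSn.
  by apply: cop_dist_le => t; have [] := CP j t.
exact: dist_le_trans (dist_le_sym adj_sym di) dj.
Qed.

(** * Separated words in the l1 plane *)

(** Robber routes are built in the integer plane with the l1 distance. There a
path with right-angled turns that goes in only one direction along each axis is
a geodesic, so that only detours in the form of a U cost anything. *)
Definition point : Type := (int * int)%type.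
Definition word := seq point.

Definition norm1 (z : point) : nat := `|z.1| + `|z.2|.
Definition endpoint (w : word) : point := (\sum_(e <- w) e)%R.

(** The distance of two words in the trie formed by all words. *)
Fixpoint tree_dist (T : eqType) (p q : seq T) : nat :=
  match p, q with
  | a :: p', b :: q' => if a == b then tree_dist p' q' else size p + size q
  | _, _ => size p + size q
  end.

Lemma tree_dist_split (T : eqType) (p q : seq T) :
  exists u p' q', [/\ p = u ++ p', q = u ++ q' & tree_dist p q = size p' + size q'].
Proof.
elim: p q => [|a p IH] [|b q] /=; do 1?[by exists [::]; do 2!eexists].
have [<-|ab] := eqVneq a b; last by exists [::]; do 2!eexists.
have [u [p' [q' [-> -> ->]]]] := IH q.
by exists (a :: u), p', q'.
Qed.

Lemma tree_dist_le (T : eqType) (p q : seq T) : tree_dist p q <= size p + size q.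
Proof.
elim: p q => [|a p IH] [|b q] //=; case: eqP => _ //.
by apply: leq_trans (IH q) _; lia.
Qed.

Lemma tree_dist_cat (T : eqType) (u p q : seq T) :
  tree_dist (u ++ p) (u ++ q) = tree_dist p q.
Proof. by elim: u => //= a u; rewrite eqxx. Qed.

Lemma tree_dist_map (T T' : eqType) (f : T -> T') (p q : seq T) :
  injective f -> tree_dist (map f p) (map f q) = tree_dist p q.
Proof.
move=> f_inj; elim: p q => [|a p IH] [|b q] //=; rewrite ?size_map //.
by rewrite (inj_eq f_inj) IH.
Qed.

Lemma tree_dist_nseq (T : eqType) (e : T) x y p q :
  tree_dist (nseq x e ++ p) (nseq y e ++ q) <= (x - y) + (y - x) + size p + size q.
Proof.
have [xy|yx] := leqP x y.
  rewrite -(subnKC xy) nseqD -catA tree_dist_cat.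
  by apply: leq_trans (tree_dist_le _ _) _; rewrite size_cat size_nseq; lia.
rewrite -(subnKC (ltnW yx)) nseqD -catA tree_dist_cat.
by apply: leq_trans (tree_dist_le _ _) _; rewrite size_cat size_nseq; lia.
Qed.

(** One letter is one robber move, and the embedding into the grid doubles the
l1 distance: hence the factor 2. *)
Definition separated (p q : word) : bool :=
  tree_dist p q < 2 * norm1 (endpoint p - endpoint q)%R.

Lemma endpoint_cat p q : endpoint (p ++ q) = (endpoint p + endpoint q)%R.
Proof. exact: big_cat. Qed.

Definition unit_step (e : point) : bool := norm1 e == 1.

Definition turn_left (z : point) : point := (- z.2, z.1)%R.
Definition turn_right (z : point) : point := (z.2, - z.1)%R.
Definition turn b := if b then turn_left else turn_right.
Definition side b : int := (if b then 1 else - 1)%R.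

Lemma turn_inj b : injective (turn b).
Proof. by case: b => -[a1 a2] [b1 b2] [] e1 e2; congr pair; lia. Qed.

Lemma endpoint_turn b w : endpoint (map (turn b) w) =
  (- side b * (endpoint w).2, side b * (endpoint w).1)%R.
Proof.
rewrite /endpoint; elim: w => [|e w IH].
  by rewrite !big_nil /=; congr pair; lia.
by rewrite /= !big_cons IH /side; case: b {IH} => /=; congr pair => /=; lia.
Qed.

Definition east : point := (1, 0)%R.

Lemma endpoint_nseq x : endpoint (nseq x east) = (x%:Z, 0)%R.
Proof.
rewrite /endpoint; elim: x => [|x IH]; first by rewrite big_nil.
by rewrite /= big_cons IH /=; congr pair => /=; lia.
Qed.

(** A copy of a word, rotated by a quarter turn, whose root lies at distance
[x] on a stem that runs eastwards. *)
Definition tooth (turn : point -> point) x w : word :=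
  nseq x east ++ map turn w.

(** The shape of a word of a cell that points eastwards. A word of length [d]
that ends at [(u, v)] has to keep clear of what lies behind the root of its
cell and of what lies in front of it. The excess of its length over twice the
distance that it gains is [d + 2 |v| - 2 u] in the first case, where it must be
negative, and [d + 2 |v| + 2 u] in the second case, where the height [h] bounds
it. These two bounds are all that is needed to combine cells. *)
Definition in_cell h (w : word) : bool :=
  let: (u, v) := endpoint w in
  [&& all unit_step w, ((size w)%:Z + 2 * `|v| < 2 * u)%R
    & ((size w)%:Z + 2 * `|v| + 2 * u < h%:Z)%R].

Lemma endpoint_tooth b x w : endpoint (tooth (turn b) x w) =
  (x%:Z - side b * (endpoint w).2, side b * (endpoint w).1)%R.
Proof.
by rewrite endpoint_cat endpoint_nseq endpoint_turn /=; congr pair => /=; lia.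
Qed.

Lemma size_tooth b x w : size (tooth (turn b) x w) = x + size w.
Proof. by rewrite size_cat size_nseq size_map. Qed.

(** The quarter turn exchanges the roles of [u] and [v]: a copy of height [h]
satisfies both bounds of the larger cell if its foot is at distance at least
[h] from the root and [3 x + h] is at most the height of that cell. *)
Lemma in_cell_tooth b x h g w :
  h <= x -> 3 * x + h <= g -> in_cell h w -> in_cell g (tooth (turn b) x w).
Proof.
move=> hx xg; rewrite /in_cell endpoint_tooth; case: (endpoint w) => u v /=.
case/and3P=> aw i1 i2; apply/and3P; split.
- rewrite all_cat all_nseq orbT /= all_map; apply: sub_all aw => -[e1 e2].
  by rewrite /unit_step /norm1; case: b => /=; lia.
- by rewrite size_tooth /side; case: b; lia.
- by rewrite size_tooth /side; case: b; lia.
Qed.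

Lemma separated_tooth_same b x p q :
  separated p q -> separated (tooth (turn b) x p) (tooth (turn b) x q).
Proof.
rewrite /separated tree_dist_cat tree_dist_map; last exact: turn_inj.
by rewrite !endpoint_tooth /norm1 /side /=; case: b; lia.
Qed.

(** Copies on opposite sides of the stem point away from each other, so that
only the bound on what lies behind them is used, and the feet may even
coincide. *)
Lemma separated_tooth_opposite b x y g h p q :
  in_cell g p -> in_cell h q ->
  separated (tooth (turn b) x p) (tooth (turn (~~ b)) y q).
Proof.
rewrite /separated /in_cell; case: b; rewrite !endpoint_tooth;
  case: (endpoint p) => u v; case: (endpoint q) => u' v' /and3P[_ p1 p2] /and3P[_ q1 q2];
  apply: leq_ltn_trans (tree_dist_nseq _ _ _ _ _) _; rewrite !size_map /norm1 /side /=; lia.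
Qed.

(** On the same side of the stem, the copy of smaller height is regarded as
facing the other one, which is regarded as turning its back: the excesses add
up to less than the smaller height, and the gap between the feet has to make up
for them. *)
Lemma separated_tooth_far b x y g h p q :
  in_cell g p -> in_cell h q -> minn g h <= (x - y) + (y - x) ->
  separated (tooth (turn b) x p) (tooth (turn b) y q).
Proof.
rewrite /separated /in_cell !endpoint_tooth.
case: (endpoint p) => u v; case: (endpoint q) => u' v' /and3P[_ p1 p2] /and3P[_ q1 q2] gh.
apply: leq_ltn_trans (tree_dist_nseq _ _ _ _ _) _; rewrite !size_map /norm1 /side /=.
by case: b; lia.
Qed.

(** * The self-similar comb *)

Lemma pairwise_flatten (T : Type) (r : rel T) (ss : seq (seq T)) :
  pairwise r (flatten ss) = all (pairwise r) ss && pairwise (allrel r) ss.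
Proof.
elim: ss => //= s ss IH; rewrite pairwise_cat IH.
have -> : allrel r s (flatten ss) = all (allrel r s) ss.
  by elim: ss {IH} => [|s' ss IH]; rewrite ?allrel0r //= allrel_catr IH.
by rewrite andbCA -!andbA; congr (_ && _); rewrite andbCA.
Qed.

Fixpoint jacobsthal n :=
  match n with
  | 0 => 0
  | 1 => 1
  | (n''.+1 as n').+1 => jacobsthal n' + 2 * jacobsthal n''
  end.

Lemma jacobsthalSS n : jacobsthal n.+2 = jacobsthal n.+1 + 2 * jacobsthal n.
Proof. by []. Qed.

Lemma jacobsthal_sum n : jacobsthal n + jacobsthal n.+1 = 2 ^ n.
Proof. by elim: n => // n IH; rewrite jacobsthalSS expnS -IH; lia. Qed.

(** In other words, the odd numbers [2 t + 1] with [t < jacobsthal n] satisfy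
[3 (2 t + 1) + 1 <= 2 ^ (n + 1)]: so many teeth of one height fit. *)
Lemma jacobsthal_le n : 3 * jacobsthal n <= 2 ^ n + 1.
Proof.
elim/ltn_ind: n => -[|[|n]] // IH.
have := IH n (leqW (leqnn _)); have := jacobsthal_sum n.
by rewrite jacobsthalSS !expnS; lia.
Qed.

(** The teeth of a cell of level [k], as pairs of a level and the position of
the foot. A tooth of level [j] stands at an odd multiple of [2 ^ (j + 2)], its
height, like the marks of a ruler, and there are as many of them as fit. *)
Definition feet k : seq (nat * nat) :=
  [seq (j, 2 ^ (j + 2) * (2 * t + 1)) | j <- iota 0 k,
                                        t <- iota 0 (jacobsthal (k - j.+1))].

Lemma feetP k j x : (j, x) \in feet k ->
  [/\ j < k, 2 ^ (j + 2) <= x, 3 * x + 2 ^ (j + 2) <= 2 ^ (k + 2)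
    & exists t, x = 2 ^ (j + 2) * (2 * t + 1)].
Proof.
case/allpairsPdep => j' [t [+ + [-> ->]]]; rewrite !mem_iota !add0n /= => jk tJ.
split=> //; [by lia | | by exists t].
have le1 : 3 * (2 * t + 1) + 1 <= 2 ^ (k - j').
  by have := jacobsthal_le (k - j'.+1); rewrite (_ : k - j' = (k - j'.+1).+1) ?expnS; lia.
rewrite (_ : k + 2 = (j' + 2) + (k - j')); last by lia.
by rewrite [2 ^ (_ + (k - _))]expnD; apply: leq_trans _ (leq_mul (leqnn _) le1); lia.
Qed.

Definition far_apart (f g : nat * nat) : bool :=
  minn (2 ^ (f.1 + 2)) (2 ^ (g.1 + 2)) <= (f.2 - g.2) + (g.2 - f.2).

Lemma far_apart_sym f g : far_apart f g = far_apart g f.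
Proof. by rewrite /far_apart minnC (addnC (f.2 - g.2)). Qed.

(** The smaller of the heights of two teeth divides the positions of both feet,
and these differ because the height of a tooth is the 2-part of the position of
its foot. *)
Lemma feet_far_apart k : pairwise far_apart (feet k).
Proof.
have : uniq (feet k).
  apply: allpairs_uniq_dep => [|j _|]; try exact: iota_uniq.
  move=> [i s] [j t] _ _ /= [<- /eqP]; rewrite eqn_pmul2l ?expn_gt0 // => /eqP e.
  by congr existT; lia.
rewrite uniq_pairwise; apply: (sub_in_pairwise (P := mem (feet k))); last exact/allP.
move=> [i x] [j y] /feetP[_ _ _ [s xE]] /feetP[_ _ _ [t yE]] /= ne.
wlog ij : i j x y s t xE yE ne / i <= j.
  move=> H; case: (leqP i j) => [|/ltnW] ij; first exact: H xE yE ne ij.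
  by rewrite far_apart_sym; apply: H yE xE _ ij; rewrite eq_sym.
rewrite /far_apart /= (minn_idPl _) ?leq_pexp2l ?leq_add2r //.
have {}ne : 2 * s + 1 <> 2 ^ (j - i) * (2 * t + 1).
  move=> e; case: (eqVneq i j) => [ij'|]; last first.
    move=> neij; have {}ij : i < j by rewrite ltn_neqAle neij.
    have /(congr1 odd) := e; rewrite oddM oddX oddD !oddM /=.
    by rewrite subn_eq0 leqNgt ij.
  by case/negP: ne; rewrite xE yE ij' e ij' subnn mul1n.
have yE' : y = 2 ^ (i + 2) * (2 ^ (j - i) * (2 * t + 1)).
  by rewrite mulnA -expnD yE; congr (2 ^ _ * _); lia.
move: (2 ^ (j - i) * (2 * t + 1)) ne yE' => z ne ->; rewrite xE.
by rewrite -!mulnBr -mulnDr leq_pmulr //; lia.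
Qed.

Definition fork (T : nat -> seq word) (f : nat * nat) : seq word :=
  map (tooth turn_left f.2) (T f.1) ++ map (tooth turn_right f.2) (T f.1).

Definition comb (T : nat -> seq word) k : seq word :=
  flatten (map (fork T) (feet k)).

Lemma forkP T f w : w \in fork T f ->
  exists b p, p \in T f.1 /\ w = tooth (turn b) f.2 p.
Proof.
by rewrite mem_cat => /orP[] /mapP[p pT ->]; [exists true|exists false]; exists p.
Qed.

Lemma eq_comb T T' k : (forall j, j < k -> T j = T' j) -> comb T k = comb T' k.
Proof.
move=> e; congr flatten; apply/eq_in_map => -[j x] /feetP[jk _ _ _].
by rewrite /fork e.
Qed.

Lemma comb_in_cell T k :
    (forall j, j < k -> all (in_cell (2 ^ (j + 2))) (T j)) ->
  all (in_cell (2 ^ (k + 2))) (comb T k).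
Proof.
move=> TP; apply/allP => w /flatten_mapP[[j x] /feetP[jk jx xk _]].
move=> /forkP[b [p [pT ->]]]; apply: in_cell_tooth jx xk _.
exact: (allP (TP j jk)).
Qed.

Lemma comb_separated T k :
    (forall j, j < k -> all (in_cell (2 ^ (j + 2))) (T j)) ->
    (forall j, j < k -> pairwise separated (T j)) ->
  pairwise separated (comb T k).
Proof.
move=> TP Tsep; rewrite pairwise_flatten all_map pairwise_map; apply/andP; split.
  apply/allP => -[j x] /feetP[jk _ _ _] /=.
  rewrite pairwise_cat !pairwise_map; apply/and3P; split.
  - apply/allrelP => _ _ /mapP[p pT ->] /mapP[q qT ->].
    exact: (separated_tooth_opposite true) (allP (TP j jk) p pT) (allP (TP j jk) q qT).
  - by apply: sub_pairwise (Tsep j jk) => p q; apply: (separated_tooth_same true).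
  - by apply: sub_pairwise (Tsep j jk) => p q; apply: (separated_tooth_same false).
apply: (sub_in_pairwise (P := mem (feet k))) (feet_far_apart k); last exact/allP.
move=> [i x] [j y] /feetP[ik _ _ _] /feetP[jk _ _ _] fxy.
apply/allrelP => _ _ /forkP[b [p [pT ->]]] /forkP[c [q [qT ->]]].
have pC := allP (TP i ik) p pT; have qC := allP (TP j jk) q qT.
have [->|] := eqVneq c b; first exact: separated_tooth_far pC qC _.
case: b c => -[] // _;
  [exact: (separated_tooth_opposite true) pC qC
  |exact: (separated_tooth_opposite false) pC qC].
Qed.

(** Truncated below level [n], since a cell refers to the cells of all lower
levels. *)
Fixpoint cell_upto n k : seq word :=
  if n is n'.+1 then
    if k is 0 then [:: [:: east]] else comb (cell_upto n') k
  else [::].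

Definition cell k := cell_upto k.+1 k.

Lemma cell_uptoE n k : k < n -> cell_upto n k = cell k.
Proof.
suff H n' : k < n -> k < n' -> cell_upto n k = cell_upto n' k by move=> /H; apply.
elim: n n' k => [|n IH] [|n'] [|k] //=; rewrite !ltnS => kn kn'.
by apply: eq_comb => j jk; apply: IH; lia.
Qed.

Lemma cellS k : cell k.+1 = comb cell k.+1.
Proof. by rewrite [LHS]/(comb (cell_upto k.+1) _); apply: eq_comb => j /cell_uptoE. Qed.

Lemma cell_in_cell k : all (in_cell (2 ^ (k + 2))) (cell k).
Proof.
elim/ltn_ind: k => -[|k] IH; last by rewrite cellS; apply: comb_in_cell.
by rewrite /= /in_cell /endpoint big_cons big_nil.
Qed.

Lemma cell_separated k : pairwise separated (cell k).
Proof.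
elim/ltn_ind: k => -[|k] IH //; rewrite cellS; apply: comb_separated => // j _.
exact: cell_in_cell.
Qed.

Lemma size_comb T k :
  size (comb T k) = 2 * \sum_(j < k) jacobsthal (k - j.+1) * size (T j).
Proof.
rewrite size_flatten /shape -map_comp sumnE big_map big_allpairs_dep /=.
rewrite -(big_mkord xpredT (fun j => jacobsthal (k - j.+1) * size (T j))).
rewrite big_distrr /= /index_iota subn0; apply: eq_bigr => j _.
rewrite (eq_bigr (fun=> 2 * size (T j))) => [|t _]; last first.
  by rewrite size_cat !size_map /= addnn mul2n.
by rewrite big_const_seq count_predT size_iota iter_addn_0; lia.
Qed.

Lemma jacobsthal_conv_rec (s : nat -> nat) k :
    \sum_(j < k.+2) jacobsthal (k.+2 - j.+1) * s j =
  \sum_(j < k.+1) jacobsthal (k.+1 - j.+1) * s j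
    + 2 * \sum_(j < k) jacobsthal (k - j.+1) * s j + s k.
Proof.
rewrite big_ord_recr big_ord_recr [in RHS]big_ord_recr /=.
rewrite !subnn subSnn !mul0n mul1n !addn0; congr (_ + _).
rewrite big_distrr -big_split /=; apply: eq_bigr => j _.
have jk := ltn_ord j; rewrite (_ : k.+2 - j.+1 = (k - j.+1).+2); last by lia.
rewrite (_ : k.+1 - j.+1 = (k - j.+1).+1); last by lia.
by rewrite jacobsthalSS mulnDl mulnA.
Qed.

(** The characteristic root of this recurrence, [(1 + sqrt 17) / 2], is the
growth rate of the construction when the side of the grid doubles. *)
Lemma size_cell_rec k : size (cell k.+3) = size (cell k.+2) + 4 * size (cell k.+1).
Proof.
have e := jacobsthal_conv_rec (fun j => size (cell j)) k.+1.
have E j := size_comb cell j.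
by rewrite cellS E e !mulnDr -!E -!cellS; lia.
Qed.

(** * Embedding into the grid *)

Lemma grid_adj_sym n : symmetric (@grid_adj n).
Proof. by move=> u v; rewrite /grid_adj eq_sym (distnC u.1) (distnC u.2). Qed.

Lemma grid_dist_le_coord n k (u v : 'I_n * 'I_n) :
  dist_le (@grid_adj n) k u v -> (`|u.1 - v.1| <= k) && (`|u.2 - v.2| <= k).
Proof.
case=> p [pp lp]; elim: p k u pp lp => [|w p IH] k u /=.
  by move=> _ -> _; rewrite !distnn.
case/andP=> /and3P[_ uw1 uw2] pp lp; case: k => // k pk.
by have /andP[] := IH k w pp lp pk; lia.
Qed.

Lemma step_towards n k (a b : 'I_n) : `|a - b| <= k.+1 ->
  exists c : 'I_n, `|a - c| <= 1 /\ `|c - b| <= k.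
Proof.
move=> ab; have an := ltn_ord a; have bn := ltn_ord b.
have [ltab|ltba|eqab] := ltngtP a b.
- have cn : a.+1 < n by lia.
  by exists (Ordinal cn) => /=; lia.
- have cn : a.-1 < n by lia.
  by exists (Ordinal cn) => /=; lia.
- by exists b; lia.
Qed.

Lemma grid_dist_le n k (u v : 'I_n * 'I_n) :
  `|u.1 - v.1| <= k -> `|u.2 - v.2| <= k -> dist_le (@grid_adj n) k u v.
Proof.
elim: k u => [|k IH] [u1 u2] /= h1 h2.
  have -> : (u1, u2) = v; last exact: dist_le_refl.
  by case: v h1 h2 => v1 v2 /= h1 h2; congr pair; apply: val_inj => /=; lia.
have [w1 [uw1 wv1]] := step_towards h1; have [w2 [uw2 wv2]] := step_towards h2.
rewrite -add1n; apply: (dist_le_trans (y := (w1, w2))); last exact: IH.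
have [->|ne] := eqVneq (u1, u2) (w1, w2); first exact: dist_leW (dist_le_refl _ _).
by exists [:: (w1, w2)]; rewrite /= /grid_adj ne uw1 uw2.
Qed.

(** Taking the sum and the difference of the coordinates turns the l1 distance
into the grid distance, and the factor 2 makes a unit step one move of the
robber. The origin goes to [(2 L, 2 L)], so that the l1 ball of radius [L] fits
into the grid; only the values in this ball are meaningful. *)
Definition place N L (z : point) : 'I_N.+1 * 'I_N.+1 :=
  (inord `|(2 * L)%:Z + 2 * (z.1 + z.2)|, inord `|(2 * L)%:Z + 2 * (z.1 - z.2)|)%R.

Lemma placeE N L z : 4 * L <= N -> norm1 z <= L ->
  (((place N L z).1)%:Z = (2 * L)%:Z + 2 * (z.1 + z.2) /\
   ((place N L z).2)%:Z = (2 * L)%:Z + 2 * (z.1 - z.2))%R.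
Proof. by move=> LN; rewrite /norm1 => zL; rewrite !inordK; lia. Qed.

Lemma place_step N L z e : 4 * L <= N -> norm1 z < L -> unit_step e ->
  dist_le (@grid_adj N.+1) 2 (place N L z) (place N L (z + e)%R).
Proof.
move=> LN zL e1; have zeL : norm1 (z + e)%R <= L.
  by move: zL e1; rewrite /unit_step /norm1 /=; lia.
have [] := placeE LN (ltnW zL); have [] := placeE LN zeL; move: e1.
case: (place N L z) (place N L (z + e)%R) => u1 u2 [v1 v2].
by rewrite /unit_step /norm1 /= => e1 w1 w2 z1 z2; apply: grid_dist_le => /=; lia.
Qed.

Lemma place_separated N L k z w : 4 * L <= N -> norm1 z <= L -> norm1 w <= L ->
  dist_le (@grid_adj N.+1) k (place N L z) (place N L w) ->
  2 * norm1 (z - w)%R <= k.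
Proof.
move=> LN zL wL /grid_dist_le_coord.
have [] := placeE LN zL; have [] := placeE LN wL.
case: (place N L z) (place N L w) => u1 u2 [v1 v2].
by rewrite /norm1 /=; lia.
Qed.

Definition grid_walk N L (z : point) (w : word) : seq ('I_N.+1 * 'I_N.+1) :=
  map (place N L) (scanl +%R z w).

Lemma grid_walk_cat N L z u p :
  grid_walk N L z (u ++ p) = grid_walk N L z u ++ grid_walk N L (z + endpoint u)%R p.
Proof.
rewrite /grid_walk scanl_cat map_cat; congr (_ ++ map _ (scanl _ _ _)).
rewrite /endpoint; elim: u z => [|e u IH] z; first by rewrite big_nil addr0.
by rewrite /= IH big_cons addrA.
Qed.

Lemma last_grid_walk N L z w :
  last (place N L z) (grid_walk N L z w) = place N L (z + endpoint w)%R.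
Proof.
rewrite /grid_walk last_map /endpoint; congr (place N L _).
elim: w z => [|e w IH] z; first by rewrite big_nil addr0.
by rewrite /= IH big_cons addrA.
Qed.

Lemma norm1_endpoint w : all unit_step w -> norm1 (endpoint w) <= size w.
Proof.
rewrite /endpoint; elim: w => [|e w IH] /=; first by rewrite big_nil.
case/andP=> + /IH; rewrite big_cons /unit_step /norm1 /=; lia.
Qed.

Lemma grid_walk_path N L z w : 4 * L <= N -> norm1 z + size w <= L -> all unit_step w ->
  path (fun u v => `[< dist_le (@grid_adj N.+1) 2 u v >]) (place N L z) (grid_walk N L z w).
Proof.
move=> LN; elim: w z => //= e w IH z zL /andP[e1 w1]; apply/andP; split.
  by apply/asboolP/place_step => //; lia.
by apply: IH => //; move: e1 zL; rewrite /unit_step /norm1 /=; lia.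
Qed.

Lemma separated_words_le N L m (W : seq word) :
    4 * L <= N -> all (all unit_step) W -> all (fun w => size w <= L) W ->
    pairwise separated W ->
  cops_can_win (@grid_adj N.+1) 2 m -> size W <= m.
Proof.
move=> LN Wunit WL Wsep win; rewrite -(card_ord (size W)).
have inW (i : 'I_(size W)) : nth [::] W i \in W by exact: mem_nth.
pose o : point := (0, 0)%R.
apply: (separated_walks_le (o := place N L o)
          (walk := fun i : 'I_(size W) => grid_walk N L o (nth [::] W i))) win => //.
- exact: grid_adj_sym.
- have le (a b : 'I_N.+1) : `|a - b| <= N.+1.
    by have := ltn_ord a; have := ltn_ord b; lia.
  move=> x; have [p [pp lp _]] := grid_dist_le (le x.1 _) (le x.2 (place N L o).2).
  by apply/connectP; exists p.
- move=> i; apply: grid_walk_path => //; last exact: (allP Wunit).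
  exact: (allP WL _ (inW i)).
move=> i j; wlog ij : i j / i < j.
  move=> H ne; case: (ltngtP i j) => [ij|ji|/val_inj e]; last by rewrite e eqxx in ne.
    exact: H.
  have [|u [p [q [-> -> nd]]]] := H j i ji; first by rewrite eq_sym.
  exists u, q, p; split=> // d; apply: nd; rewrite addnC.
  by apply: dist_le_sym d; apply: grid_adj_sym.
move=> _; have := pairwiseP [::] Wsep i j (ltn_ord i) (ltn_ord j) ij.
have [u [p [q [ep eq]]]] := tree_dist_split (nth [::] W i) (nth [::] W j).
rewrite /separated => -> sep; exists (grid_walk N L o u),
  (grid_walk N L (o + endpoint u)%R p), (grid_walk N L (o + endpoint u)%R q).
split;
  [by rewrite ep grid_walk_cat | by rewrite eq grid_walk_cat |].
rewrite !last_grid_walk !add0r /grid_walk !size_map !size_scanl => /place_separated H.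
suff : 2 * norm1 (endpoint (nth [::] W i) - endpoint (nth [::] W j))%R
    <= size p + size q by lia.
by apply: H => //; apply: leq_trans (norm1_endpoint _) _;
  rewrite ?(allP Wunit) ?(allP WL (nth _ _ _)).
Qed.

Lemma in_cell_walkable h w : in_cell h w -> all unit_step w && (size w <= h).
Proof. by rewrite /in_cell; case: (endpoint w) => u v /and3P[-> i1 i2]; lia. Qed.

Lemma size_cell_le N k m : 2 ^ (k + 4) <= N ->
  cops_can_win (@grid_adj N.+1) 2 m -> size (cell k) <= m.
Proof.
move=> kN; have inC := sub_all (@in_cell_walkable _) (cell_in_cell k).
move: inC; rewrite all_predI => /andP[cu cs].
apply: (separated_words_le _ cu cs); last exact: cell_separated.
by move: kN; rewrite !expnD; lia.
Qed.

Local Open Scope ring_scope.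

(** * The exponent *)

Lemma expn_ratio_le : (2 ^ 1357 * 130 ^ 1000 <= 333 ^ 1000)%N.
Proof.
(* Binary numbers make the comparison of these 8400-bit integers feasible. *)
have e a b : (a ^ b)%N = N.to_nat (N.of_nat a ^ N.of_nat b)%num by lia.
rewrite !e; apply/ssrnat.leP; rewrite -multE -N2Nat.inj_mul.
suff : (N.of_nat 2 ^ N.of_nat 1357 * N.of_nat 130 ^ N.of_nat 1000
          <= N.of_nat 333 ^ N.of_nat 1000)%num by lia.
by apply/N.leb_le; vm_compute.
Qed.

(** A rational number between [2 ^ 1.357] and [(1 + sqrt 17) / 2], which agree
in their first four decimals. *)
Definition growth (R : realType) : R := 333 / 130.

Lemma powR_le_growth (R : realType) : 2 `^ (1357%:R / 1000%:R) <= growth R.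
Proof.
have g0 : 0 <= growth R by rewrite /growth; lra.
rewrite -(ler_pXn2r (n := 1000)) ?nnegrE ?powR_ge0 //.
rewrite -powR_mulrn ?powR_ge0 // -powRrM divfK ?pnatr_eq0 //.
rewrite powR_mulrn // /growth expr_div_n ler_pdivlMr ?exprn_gt0 //.
by rewrite -!natrX -natrM ler_nat expn_ratio_le.
Qed.

(** Holds by induction because [growth R] squared is at most [growth R + 4];
the cell of level 1 is empty, which is why the levels start at 2. *)
Lemma growth_size_cell (R : realType) k :
  growth R ^+ k <= growth R * (size (cell k.+2))%:R.
Proof.
have g1 : growth R * growth R <= growth R + 4 by rewrite /growth; lra.
have g0 : 0 < growth R by rewrite /growth; lra.
suff : growth R ^+ k <= growth R * (size (cell k.+2))%:R
    /\ growth R ^+ k.+1 <= growth R * (size (cell k.+3))%:R by case.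
have s2 : size (cell 2) = 2%N by rewrite cellS size_comb !big_ord_recr big_ord0.
have s1 : size (cell 1) = 0%N by rewrite cellS size_comb !big_ord_recr big_ord0.
elim: k => [|k [IH1 IH2]].
  by rewrite size_cell_rec s2 s1 /growth; split; lra.
split=> //; rewrite size_cell_rec natrD natrM.
apply: (@le_trans _ _ ((growth R + 4) * growth R ^+ k)).
  by rewrite !exprS mulrA ler_wpM2r // exprn_ge0 // ltW.
by move: IH2; rewrite exprS; lra.
Qed.

Theorem theorem1p1 (R : realType) :
  exists c : R, 0 < c /\
    exists n0 : nat, forall n : nat, (n0 <= n)%N ->
      c * n%:R `^ (1357%:R / 1000%:R) <= (grid_covering_number n)%:R.
Proof.
have g0 : 0 < growth R by rewrite /growth; lra.
exists (growth R ^- 8); split; first by rewrite invr_gt0 exprn_gt0.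
(* The comb of level 2, the smallest one in use, needs [2 ^ 6 < n]. *)
exists 66%N => -[//|N] N65.
have [k kN Nk] : exists2 k, (2 ^ (k + 6) <= N)%N & (N.+1 <= 2 ^ (k + 7))%N.
  exists (trunc_log 2 N - 6)%N.
    rewrite subnK; first by apply: trunc_logP; lia.
    by apply: trunc_log_max => //; lia.
  apply: leq_trans (trunc_log_ltn N (isT : 1 < 2)%N) _.
  by rewrite leq_pexp2l //; lia.
have [win _] := covering_numberP (@grid_adj N.+1) 2 (ord0, ord0).
have le_cov := size_cell_le (k := k.+2) _ win.
rewrite ler_pdivrMl ?exprn_gt0 //.
apply: (@le_trans _ _ (growth R ^+ (k + 7))).
  apply: (@le_trans _ _ ((2 ^ (k + 7))%:R `^ (1357%:R / 1000%:R))).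
    by rewrite ge0_ler_powR ?nnegrE ?ler0n ?ler_nat ?divr_ge0.
  rewrite natrX -powR_mulrn // -powRrM mulrC powRrM powR_mulrn ?powR_ge0 //.
  by apply: lerXn2r (powR_le_growth R); rewrite nnegrE ?powR_ge0 // ltW.
rewrite (addnC k) exprD (exprSr _ 7) -[leRHS]mulrA.
rewrite (ler_pM2l (exprn_gt0 7 g0)).
apply: le_trans (growth_size_cell _ _) _; rewrite ler_pM2l // ler_nat.
by apply: le_cov; rewrite !addSn -!addnS.
Qed.
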